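(* Let $\lambda=(\lambda_j)_{j\in\mathbb{N}}\in(0,\frac12)^{\mathbb{N}}$ be a sequence such that $\lambda_n<\frac13$ for infinitely many terms and there is $k_0\in\mathbb{N}\cup\{0\}$ such that $\lambda_{k_0+1}>\frac13$. Let $(k_n)_{n\in\mathbb{N}}$ be the increasing sequence of all indices $j>k_0$ with $\lambda_j<\frac13$, and put $d_0=1$, $d_n=\lambda_1\cdots\lambda_n$ for $n\in\mathbb{N}$. Then the following conditions are equivalent. (1) There is a sequence $(\delta_n)_{n\in\mathbb{N}}$ such that for any $n\in\mathbb{N}$ $$\left\{\begin{array}{l}3d_r-d_{r-1}=\delta_n \text{ if } k_{n-1}<r<k_n,\\ 4d_{k_n}=\delta_n+\delta_{n+1},\\ d_{k_n-1}-d_{k_n}=\delta_n-\delta_{n+1}.\end{array}\right.$$ (2) For any $r\in\mathbb{N}$, we have: $$\begin{array}{lll}3d_{r+1}=4d_r-d_{r-1}&\text{if}&\lambda_r,\lambda_{r+1}\ge\frac13\text{ or }\lambda_r,\lambda_{r+1}<\frac13,\\ 3d_{r+1}=5d_r-2d_{r-1}&\text{if}&\lambda_r\ge\frac13\text{ and }\lambda_{r+1}<\frac13,\\ 6d_{r+1}=7d_r-d_{r-1}&\text{if}&\lambda_r<\frac13\text{ and }\lambda_{r+1}\ge\frac13.\end{array}$$ (3) For any $r\in\mathbb{N}$, we have: $$\begin{array}{lll}3\lambda_r\lambda_{r+1}=4\lambda_r-1&\text{if}&\lambda_r,\lambda_{r+1}\ge\frac13\text{ or }\lambda_r,\lambda_{r+1}<\frac13,\\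 3\lambda_r\lambda_{r+1}=5\lambda_r-2&\text{if}&\lambda_r\ge\frac13\text{ and }\lambda_{r+1}<\frac13,\\ 6\lambda_r\lambda_{r+1}=7\lambda_r-1&\text{if}&\lambda_r<\frac13\text{ and }\lambda_{r+1}\ge\frac13.\end{array}$$
   Context: $\mathbb{N}=\{1,2,\dots\}$.
   Formalization: Conditions (2) and (3) are required for all r > k_0 instead of all r in N, because for k_0 > 0 condition (1) does not constrain λ_1,…,λ_{k_0} and the equivalence as printed fails; for k_0 = 0 it is unchanged. *)

(* Defs.v *)
From HB Require Import structures.
From mathcomp Require Import all_boot all_order all_algebra reals.

Set Implicit Arguments.
Unset Strict Implicit.
Unset Printing Implicit Defensive.

Import Order.TTheory GRing.Theory Num.Theory.
Local Open Scope ring_scope.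

(* Sequences indexed by {1, 2, ...} are functions on nat whose value at 0 is
   never used; the one exception is k, whose value k 0 is the number k_0. *)

Definition d (R : realType) (lambda : nat -> R) (n : nat) : R :=
  \prod_(1 <= j < n.+1) lambda j.

Definition enumerates_small (R : realType) (lambda : nat -> R)
    (k0 : nat) (k : nat -> nat) : Prop :=
  [/\ k 0%N = k0,
      forall n, (0 < n)%N -> (k n < k n.+1)%N
    & forall j, ((k0 < j)%N /\ lambda j < 1 / 3) <->
                (exists2 n, (0 < n)%N & k n = j)].

Definition delta_condition (R : realType) (lambda : nat -> R)
    (k : nat -> nat) : Prop :=
  exists delta : nat -> R, forall n, (0 < n)%N ->
    [/\ forall r, (k n.-1 < r < k n)%N ->
          3 * d lambda r - d lambda r.-1 = delta n,
        4 * d lambda (k n) = delta n + delta n.+1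
      & d lambda (k n).-1 - d lambda (k n) = delta n - delta n.+1].

(* The recurrences are required for r > k0 only: for r <= k0 they involve
   lambda_1, ..., lambda_k0, on which delta_condition puts no constraint.
   For k0 = 0 this is every r >= 1. *)

Definition d_recurrence (R : realType) (lambda : nat -> R)
    (k0 : nat) : Prop :=
  forall r, (k0 < r)%N ->
    [/\ (1 / 3 <= lambda r /\ 1 / 3 <= lambda r.+1) \/
        (lambda r < 1 / 3 /\ lambda r.+1 < 1 / 3) ->
          3 * d lambda r.+1 = 4 * d lambda r - d lambda r.-1,
        1 / 3 <= lambda r /\ lambda r.+1 < 1 / 3 ->
          3 * d lambda r.+1 = 5 * d lambda r - 2 * d lambda r.-1
      & lambda r < 1 / 3 /\ 1 / 3 <= lambda r.+1 ->
          6 * d lambda r.+1 = 7 * d lambda r - d lambda r.-1].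

Definition lambda_recurrence (R : realType) (lambda : nat -> R)
    (k0 : nat) : Prop :=
  forall r, (k0 < r)%N ->
    [/\ (1 / 3 <= lambda r /\ 1 / 3 <= lambda r.+1) \/
        (lambda r < 1 / 3 /\ lambda r.+1 < 1 / 3) ->
          3 * lambda r * lambda r.+1 = 4 * lambda r - 1,
        1 / 3 <= lambda r /\ lambda r.+1 < 1 / 3 ->
          3 * lambda r * lambda r.+1 = 5 * lambda r - 2
      & lambda r < 1 / 3 /\ 1 / 3 <= lambda r.+1 ->
          6 * lambda r * lambda r.+1 = 7 * lambda r - 1].

(* Main.v *)
Require Import Defs.
From HB Require Import structures.
From mathcomp Require Import all_boot all_order all_algebra reals.
From mathcomp Require Import lra.

Set Implicit Arguments.
Unset Strict Implicit.
Unset Printing Implicit Defensive.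

Import Order.TTheory GRing.Theory Num.Theory.
Local Open Scope ring_scope.

(* To each index r attach two linear forms in (d_{r-1}, d_r), an incoming and an
   outgoing value.  They agree when lambda_r >= 1/3; at r = k_n they are the
   unique delta_n and delta_{n+1} solving the last two equations of (1).  All
   cases of (2) then say that the outgoing value at r is the incoming value at
   r + 1, whereas (1) says that the incoming value is constant, equal to
   delta_n, on k_{n-1} < r <= k_n and that the outgoing value at k_n is
   delta_{n+1}.  Finally (3) is (2) divided by d_{r-1}. *)

Definition incoming (R : realType) (lambda : nat -> R) (r : nat) : R :=
  if lambda r < 1 / 3 then (3 * d lambda r + d lambda r.-1) / 2
  else 3 * d lambda r - d lambda r.-1.

Definition outgoing (R : realType) (lambda : nat -> R) (r : nat) : R :=
  if lambda r < 1 / 3 then (5 * d lambda r - d lambda r.-1) / 2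
  else 3 * d lambda r - d lambda r.-1.

Lemma d_rec (R : realType) (lambda : nat -> R) (r : nat) :
  d lambda r.+1 = d lambda r * lambda r.+1.
Proof. by rewrite /d big_nat_recr. Qed.

Lemma d_neq0 (R : realType) (lambda : nat -> R) (r : nat) :
  (forall j, (0 < j)%N -> lambda j != 0) -> d lambda r != 0.
Proof.
move=> lambda_neq0; elim: r => [|r IHr]; first by rewrite /d big_geq ?oner_neq0.
by rewrite d_rec mulf_neq0 ?lambda_neq0.
Qed.

Lemma d_recurrenceP (R : realType) (lambda : nat -> R) (k0 : nat) :
  d_recurrence lambda k0 <->
  forall r, (k0 < r)%N -> incoming lambda r.+1 = outgoing lambda r.
Proof.
split=> rec r /rec; rewrite /incoming /outgoing /=.
  move=> [same big_small small_big].
  case: (ltrP (lambda r.+1)) => lt1; case: (ltrP (lambda r)) => lt0.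
  - by have := same (or_intror (conj lt0 lt1)); lra.
  - by have := big_small (conj lt0 lt1); lra.
  - by have := small_big (conj lt0 lt1); lra.
  - by have := same (or_introl (conj lt0 lt1)); lra.
case: (ltrP (lambda r.+1)) => lt1; case: (ltrP (lambda r)) => lt0 eq_io;
  by split=> [[[]|[]]|[]|[]]; lra.
Qed.

Lemma d_lambda_recurrence (R : realType) (lambda : nat -> R) (k0 : nat) :
  (forall j, (0 < j)%N -> lambda j != 0) ->
  d_recurrence lambda k0 <-> lambda_recurrence lambda k0.
Proof.
(* The index is positive, so it is written [r.+1]; every term of (2) then becomes a multiple of the
   nonzero [d lambda r], which is cancelled or multiplied back. *)
move=> lambda_neq0; split=> rec [//|r] /rec; rewrite /= !d_rec;
  move=> [same big_small small_big]; split=> [/same|/big_small|/small_big] eq_r.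
1-3: apply: (mulfI (d_neq0 r lambda_neq0)); lra.
1-3: by move/(congr1 ( *%R (d lambda r))): eq_r; lra.
Qed.

Section Enumeration.

Variables (R : realType) (lambda : nat -> R) (k0 : nat) (k : nat -> nat).
Hypothesis k_enum : enumerates_small lambda k0 k.

Lemma k_gt_k0 n : (0 < n)%N -> (k0 < k n)%N.
Proof.
by case: k_enum => _ _ kP n_gt0; case: (kP (k n)) => _ []; first by exists n.
Qed.

Lemma k_small n : (0 < n)%N -> lambda (k n) < 1 / 3.
Proof.
by case: k_enum => _ _ kP n_gt0; case: (kP (k n)) => _ []; first by exists n.
Qed.

(** Growth is assumed from index 1 on; the step from [k 0 = k0] holds because all enumerated indices
    exceed [k0]. *)
Lemma k_ltS n : (k n < k n.+1)%N.
Proof.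
case: n => [|n]; last by case: k_enum => _ + _; apply.
by case: (k_enum) => -> _ _; apply: k_gt_k0.
Qed.

(** Otherwise [r] would be some [k m], and monotonicity would give [n < m < n.+1]. *)
Lemma lambda_between n r : (k n < r < k n.+1)%N -> 1 / 3 <= lambda r.
Proof.
have k_mono := homo_ltn ltn_trans k_ltS.
case: k_enum => k0E _ kP /andP[ltnr ltrn]; rewrite leNgt; apply/negP => small_r.
have lt_k0r : (k0 < r)%N.
  by case: n {ltrn} ltnr => [|n]; [rewrite k0E | apply/ltn_trans/k_gt_k0].
have [m _ km] := (kP r).1 (conj lt_k0r small_r).
move: ltnr ltrn; rewrite -km !(leqW_mono (leq_mono k_mono)) ltnS => lt_nm.
by rewrite leqNgt lt_nm.
Qed.

(** Blocks include their right end because (1) ties [k n.+1] to the same [delta n.+1] as the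
    interior. *)
Lemma k_cover r : (k0 < r)%N -> exists n, (k n < r <= k n.+1)%N.
Proof.
case: (k_enum) => k0E _ _.
elim: r => // r IHr; rewrite ltnS leq_eqVlt => /orP[/eqP <-|/IHr[n /andP[lo hi]]].
  by exists 0%N; rewrite k0E ltnSn -k0E k_ltS.
move: hi; rewrite leq_eqVlt => /orP[/eqP ->|hi].
  by exists n.+1; rewrite ltnSn k_ltS.
by exists n; rewrite hi ltnW.
Qed.

Lemma delta_conditionP :
  delta_condition lambda k <->
  forall r, (k0 < r)%N -> incoming lambda r.+1 = outgoing lambda r.
Proof.
split=> [[delta deltaP] | step].
  (* In the interior this is the first equation of (1); at the right end, half the sum of the other
     two. *)
  have incE n r : (k n < r <= k n.+1)%N -> incoming lambda r = delta n.+1.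
    case/andP=> lo; rewrite leq_eqVlt /incoming => /orP[/eqP ->|hi].
      by rewrite k_small //; case: (deltaP n.+1 isT) => _; lra.
    have between : (k n < r < k n.+1)%N by rewrite lo.
    rewrite ltNge (lambda_between between) /=.
    by case: (deltaP n.+1 isT) => /(_ r between).
  move=> r /k_cover[n /andP[lo]]; rewrite leq_eqVlt => /orP[/eqP ->|hi].
    (* Here [r.+1] opens the next block, with value [delta n.+2], which is half the difference of
       the last two equations. *)
    rewrite (incE n.+1) ?ltnSn ?k_ltS // /outgoing k_small //.
    by case: (deltaP n.+1 isT) => _; lra.
  have between : (k n < r < k n.+1)%N by rewrite lo.
  rewrite (incE n r.+1) ?hi ?andbT; last exact: ltnW.
  by have := incE n r; rewrite lo (ltnW hi) => <- //;
    rewrite /incoming /outgoing ltNge (lambda_between between).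
have k0_lt n r : (k n < r)%N -> (k0 < r)%N.
  by case: n => [|n]; [case: (k_enum) => -> | apply/ltn_trans/k_gt_k0].
(* Induction on the distance [m] to the right end of the block: before that end, incoming and
   outgoing values agree, so [step] passes from [r] to [r.+1]. *)
have inc_const n m r : (r + m)%N = k n.+1 -> (k n < r)%N ->
    incoming lambda r = incoming lambda (k n.+1).
  elim: m r => [|m IHm] r; first by rewrite addn0 => ->.
  rewrite addnS -addSn => rm lo; rewrite -(IHm r.+1) ?leqW //.
  rewrite step ?(k0_lt n) // /incoming /outgoing ltNge (@lambda_between n) //.
  by rewrite lo -rm ltnS leq_addr.
exists (fun n => incoming lambda (k n)); case=> [//|n] _.
(* [step] reaches only the first index after [k n.+1]; constancy on the block carries the value on
   to [k n.+2]. *)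
have inc_next : incoming lambda (k n.+2) = outgoing lambda (k n.+1).
  rewrite -step ?k_gt_k0 //.
  by rewrite (inc_const n.+1 (k n.+2 - (k n.+1).+1)%N) // subnKC // k_ltS.
split=> [r /= between||].
- case/andP: (between) => lo hi.
  rewrite -(inc_const n (k n.+1 - r)%N r) ?subnKC ?(ltnW hi) //.
  by rewrite /incoming ltNge (lambda_between between).
(* The sum and the difference of the incoming and outgoing forms at [k n.+1] are the two left-hand
   sides. *)
- by rewrite inc_next /incoming /outgoing k_small //; lra.
- by rewrite inc_next /incoming /outgoing k_small //; lra.
Qed.

End Enumeration.

Theorem proposition2p6 (R : realType) (lambda : nat -> R)
    (k0 : nat) (k : nat -> nat)
    (lambda_range : forall j, (0 < j)%N -> 0 < lambda j < 1 / 2)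
    (lambda_inf_small : forall N, exists2 j, (N < j)%N & lambda j < 1 / 3)
    (lambda_k0 : 1 / 3 < lambda k0.+1)
    (k_enum : enumerates_small lambda k0 k) :
  [<-> delta_condition lambda k;
       d_recurrence lambda k0;
       lambda_recurrence lambda k0].
Proof.
have lambda_neq0 j : (0 < j)%N -> lambda j != 0.
  by move=> /lambda_range /andP[]; rewrite lt0r => /andP[].
have [lambda_of_d d_of_lambda] := d_lambda_recurrence k0 lambda_neq0.
tfae; first by move/(delta_conditionP k_enum)/d_recurrenceP.
  by [].
by move/d_of_lambda/d_recurrenceP/(delta_conditionP k_enum).
Qed.
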